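(* Let $\mathbb{K}$ be a field, let $A_1,\ldots,A_m \in \mathbb{K}^{n\times n}$, and let $A=\sum_{k=1}^m A_k x_k$. Then $$\frac12\,{\cal Q}(A)\subseteq{\cal P}(A).$$
   Context: Notation: $[n]=\{1,\ldots,n\}$, and $x_1,\ldots,x_m$ are indeterminates. For $I,J\subseteq[n]$, $A[I,J]$ is the submatrix of $A$ with row index set $I$ and column index set $J$; the determinant of the empty matrix is $1$. For a multivariate polynomial $p$, $\operatorname{supp} p$ denotes the set of exponent vectors of monomials appearing in $p$ with nonzero coefficient. $\operatorname{Conv}$ denotes convex hull, and $\alpha{\cal P}=\{\alpha u\mid u\in{\cal P}\}$. The polytope ${\cal P}(A)\subseteq\mathbb{R}^m$ is $${\cal P}(A)=\operatorname{Conv}\bigcup_{I,J\subseteq[n]:\,|I|=|J|}\operatorname{supp}\det A[I,J],$$ where $x_1,\ldots,x_m$ are regarded as commuting variables. For $d\ge 1$ and $I,J\subseteq[n]$, the blow-up is $A[I,J]^{\{d\}}=\sum_{k=1}^m A_k[I,J]\otimes X_k$, where $X_k=(x_{k,ij})_{i,j\in[d]}$ is a $d\times d$ matrix whose entries $x_{k,ij}$ ($k\in[m]$, $i,j\in[d]$) are distinct commuting indeterminates, and $\otimes$ is the Kronecker product. For $|I|=|J|$, $\operatorname{supp}\det A[I,J]^{\{d\}}$ is a set of integer vectors $z=(z_{k,ij})_{k\in[m],i,j\in[d]}$. For such $z$ define $\operatorname{proj}_d(z)\in\mathbb{Q}^m_{\ge0}$ by $\operatorname{proj}_d(z)_k=\frac1d\sum_{i,j\in[d]}z_{k,ij}$.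 Put $${\cal S}^d_\ell=\bigcup_{I,J\subseteq[n]:\,|I|=|J|=\ell}\operatorname{proj}_d(\operatorname{supp}\det A[I,J]^{\{d\}}),\qquad {\cal Q}(A)=\operatorname{Conv}\bigcup_{d=1}^\infty\bigcup_{\ell=0}^n{\cal S}^d_\ell .$$ *)

(* Defs.v *)
From HB Require Import structures.
From mathcomp Require Import all_boot all_order all_algebra.
From mathcomp Require Import mxtens mpoly.
From mathcomp Require Import classical_sets reals convex.

Set Implicit Arguments.
Unset Strict Implicit.
Unset Printing Implicit Defensive.

Import GRing.Theory Num.Theory.

Local Open Scope classical_set_scope.
Local Open Scope ring_scope.

Definition convex_hull (R : realType) (m : nat) (S : set 'rV[R]_m) :
    set 'rV[R]_m :=
  smallest (@convex_set R 'rV[R]_m) S.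

(* The square submatrix with row set I and column set J, where the elements of
   I and of J are taken in increasing order. *)
Definition square_submx (T : Type) (n l : nat) (I J : {set 'I_n})
    (hI : #|I| = l) (hJ : #|J| = l) (M : 'M[T]_n) : 'M[T]_l :=
  mxsub (fun i : 'I_l => enum_val (cast_ord (esym hI) i))
        (fun j : 'I_l => enum_val (cast_ord (esym hJ) j)) M.

Section Polytopes.

Variables (K : fieldType) (R : realType) (m n : nat) (A : 'I_m -> 'M[K]_n).

Definition symbolic_mx : 'M[{mpoly K[m]}]_n :=
  \sum_(k < m) 'X_k *: map_mx (@mpolyC m K) (A k).

Definition expvec (u : 'X_{1..m}) : 'rV[R]_m := \row_k (u k)%:R.

Definition polytopeP : set 'rV[R]_m :=
  convex_hull
    [set v | exists l (I J : {set 'I_n}) (hI : #|I| = l) (hJ : #|J| = l)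
               (u : 'X_{1..m}),
               u \in msupp (\det (square_submx hI hJ symbolic_mx)) /\
               v = expvec u].

(* The indeterminates x_{k,ij} are indexed by the triples (k, i, j). *)
Definition bvars (d : nat) : finType := ('I_m * 'I_d * 'I_d)%type.

Definition bvar (d : nat) (k : 'I_m) (i j : 'I_d) : 'I_#|bvars d| :=
  enum_rank ((k, i, j) : bvars d).

Definition varmx (d : nat) (k : 'I_m) : 'M[{mpoly K[#|bvars d|]}]_d :=
  \matrix_(i, j) 'X_(bvar k i j).

Definition blowup (d l : nat) (I J : {set 'I_n}) (hI : #|I| = l)
    (hJ : #|J| = l) : 'M[{mpoly K[#|bvars d|]}]_(l * d) :=
  \sum_(k < m)
    (map_mx (@mpolyC #|bvars d| K) (square_submx hI hJ (A k)) *t varmx d k).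

Definition projd (d : nat) (z : 'X_{1..#|bvars d|}) : 'rV[R]_m :=
  \row_k (d%:R^-1 * \sum_(i < d) \sum_(j < d) (z (bvar k i j))%:R).

Definition layerS (d l : nat) : set 'rV[R]_m :=
  [set v | exists (I J : {set 'I_n}) (hI : #|I| = l) (hJ : #|J| = l)
             (z : 'X_{1..#|bvars d|}),
             z \in msupp (\det (blowup d hI hJ)) /\ v = projd z].

Definition polytopeQ : set 'rV[R]_m :=
  convex_hull
    (\bigcup_(d in [set d | (0 < d)%N])
      \bigcup_(l in [set l | (l <= n)%N]) layerS d l).

End Polytopes.

Arguments polytopeP {K} R {m n} A.
Arguments polytopeQ {K} R {m n} A.

(* Main.v *)
Require Import Defs.
From mathcomp Require Import all_boot all_order all_algebra.
From mathcomp Require Import perm.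
From mathcomp Require Import mxtens mpoly.
From mathcomp Require Import classical_sets interval_inference reals convex.

Set Implicit Arguments.
Unset Strict Implicit.
Unset Printing Implicit Defensive.

Import Order.TTheory GRing.Theory Num.Theory.

Local Open Scope classical_set_scope.
Local Open Scope ring_scope.

(**
Since P(A) is the convex hull of finitely many points, a point outside it is
strictly separated from these points by a weight vector c
([convex_separation]).  So it is enough to show, for every real weight c on the
variables, that the weighted degree of det A[I,J]^{d} in the variables x_{k,ij},
each of weight c_k, is at most 2 d mu, where mu is the largest weighted degree
of a minor of A ([blowup_bound]).  One may replace A by A[I,J], so that only the
full determinant of a blow-up of an l x l symbolic matrix M has to be bounded.

The minors of M are, up to sign, the maximal minors of the l x 2l matrix
[1 M].  Choose l columns, forming a matrix H, whose determinant beta has the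
largest weighted degree mu, and let Z be the matrix of the other l columns.
By the rule of Cramer the entries of N = H^-1 Z are quotients of maximal minors
by beta, hence have degree at most 0.  Let X and Y be the parts of [0 1] in the
columns of H and of Z, so that the partial derivative in x_k sends H to A_k X
and Z to A_k Y.  Differentiating H N = Z gives
   A_k (Y - X N) = H (dN/dx_k),
and differentiation in x_k lowers the weighted degree by c_k.  The square
matrices H and Q = Y - X N satisfy det H = beta and det Q = +-1/beta
([det_pivot]): Q is the Schur complement of H in a column permutation of the
unitriangular matrix [1 M; 0 1].  Thus every A_k equals
H (dN/dx_k) Q^-1 with fixed H and Q, and taking the tensor product with generic
matrices X_k yields
   det (sum_k A_k (x) X_k) = +- beta^(2d) det (sum_k (dN/dx_k) (x) X_k),
where the entries of the last matrix have joint degree at most 0.  This is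
the bound 2 d mu; the two factors H and Q^-1 account for the constant 1/2.

To stay inside polynomial rings the formal development clears denominators: it
uses U = adj(H) Z = beta N, the matrix beta Y - X U = beta Q and the matrices
G_k = beta dU/dx_k - (dbeta/dx_k) U = beta^2 dN/dx_k.  The final identity is
read off coefficientwise in K[x][X].
*)

(** * Separation from the convex hull of a finite set *)

Definition dot (F : pzRingType) (N : nat) (a x : 'rV[F]_N) : F :=
  \sum_k a 0 k * x 0 k.

Lemma dotDr (F : pzRingType) N (a x y : 'rV[F]_N) :
  dot a (x + y) = dot a x + dot a y.
Proof. by rewrite -big_split; apply: eq_bigr => k _; rewrite mxE mulrDr. Qed.

Lemma dotC (F : comPzRingType) N (a x : 'rV[F]_N) : dot a x = dot x a.
Proof. by apply: eq_bigr => k _; rewrite mulrC. Qed.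

Lemma dotZr (F : comPzRingType) N t (a x : 'rV[F]_N) :
  dot a (t *: x) = t * dot a x.
Proof. by rewrite mulr_sumr; apply: eq_bigr => k _; rewrite mxE mulrCA. Qed.

Lemma dotDl (F : comPzRingType) N (a b x : 'rV[F]_N) :
  dot (a + b) x = dot a x + dot b x.
Proof. by rewrite !(dotC _ x) dotDr. Qed.

Lemma dotZl (F : comPzRingType) N t (a x : 'rV[F]_N) :
  dot (t *: a) x = t * dot a x.
Proof. by rewrite !(dotC _ x) dotZr. Qed.

Lemma dot_self_gt0 (F : realFieldType) N (a : 'rV[F]_N) :
  a != 0 -> 0 < dot a a.
Proof.
move=> a0; rewrite lt_def sumr_ge0 ?andbT => [|k _]; last first.
  by rewrite -expr2 sqr_ge0.
apply: contraNneq a0 => /psumr_eq0P a0; apply/eqP/rowP => k.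
have /eqP := a0 (fun k _ => sqr_ge0 (a 0 k)) k isT.
by rewrite mxE mulf_eq0 orbb => /eqP.
Qed.

Lemma dot_row_mx (F : pzRingType) N1 N2 (a x : 'rV[F]_N1) (b y : 'rV[F]_N2) :
  dot (row_mx a b) (row_mx x y) = dot a x + dot b y.
Proof.
rewrite /dot big_split_ord; congr (_ + _); apply: eq_bigr => k _.
  by rewrite !row_mxEl.
by rewrite !row_mxEr.
Qed.

(** The alternative of Farkas, by the induction of Bartl on the number of
generators.  The cone is any set [C] closed under the conic operations, so no
coefficients occur.  If [g] is separated from [s] by [x0] and [b] is on the
wrong side of [x0], the projection along [b] onto the hyperplane orthogonal to
[x0] reduces [b :: s] to [s]; it moves the generators inside [C], because it
adds nonnegative multiples of [b]. *)
Lemma farkas (F : realFieldType) N (C : 'rV[F]_N -> Prop) (s : seq 'rV[F]_N) g :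
    C 0 -> (forall x y, C x -> C y -> C (x + y)) ->
    (forall t x, 0 <= t -> C x -> C (t *: x)) ->
    (forall a, a \in s -> C a) ->
  C g \/ exists2 x, forall a, a \in s -> dot a x <= 0 & 0 < dot g x.
Proof.
move=> C0 CD CZ; have [k] := ubnP (size s).
elim: k s g => // k IHk [|b s] g /= lt_sk Cs.
  have [->|g0] := eqVneq g 0; first by left.
  by right; exists g; rewrite ?dot_self_gt0.
have Cb : C b by apply: Cs; rewrite mem_head.
have {}Cs a : a \in s -> C a by move=> sa; apply: Cs; rewrite inE sa orbT.
have [//|Cg|[x0 sx0 gx0]] := IHk s g lt_sk; [by left | ].
have [bx0 | bx0] := lerP (dot b x0) 0.
  by right; exists x0 => // a; rewrite inE => /predU1P[->|/sx0].
pose p a := a - ((dot a x0) / (dot b x0)) *: b.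
have Cp a : a \in s -> C (p a).
  move=> sa; rewrite /p -scaleNr; apply: CD; first exact: Cs.
  by apply: CZ => //; rewrite -mulNr divr_ge0 ?oppr_ge0 ?sx0 // ltW.
have dotp a x : dot (p a) x = dot a (x - (dot b x / dot b x0) *: x0).
  rewrite /p -!scaleNr dotDl dotDr dotZl dotZr; congr (_ + _).
  by rewrite !mulNr; congr (- _); rewrite mulrAC -mulrA mulrC.
have [||Cpg|[x sx gx]] := IHk [seq p a | a <- s] (p g).
- by rewrite size_map.
- by move=> _ /mapP[a sa ->]; apply: Cp.
- left; rewrite -[g](subrK ((dot g x0 / dot b x0) *: b)); apply: CD => //.
  by apply: CZ => //; rewrite divr_ge0 ?ltW.
right; exists (x - (dot b x / dot b x0) *: x0); last by rewrite -dotp.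
move=> a; rewrite inE => /predU1P[->|sa]; last first.
  by rewrite -dotp sx ?map_f.
by rewrite -scaleNr dotDr dotZr mulNr divfK ?subrr ?gt_eqF.
Qed.

Lemma convex_set_comb (R : realType) m (P : set 'rV[R]_m) x y (t : R) :
    @convex_set R 'rV[R]_m P -> P x -> P y -> 0 <= t -> t <= 1 ->
  P (t *: x + (1 - t) *: y).
Proof.
move=> cP Px Py t0 t1.
by have := cP x y (Itv01 t0 t1); rewrite !inE => /(_ Px Py).
Qed.

(** Homogenization: [g] is in [P] exactly when [(g, 1)] is in the cone over [P],
and a separating functional of the cone restricts to an affine functional at
height 1. *)
Lemma convex_separation (R : realType) m (P : set 'rV[R]_m)
    (s : seq 'rV[R]_m) g :
    @convex_set R 'rV[R]_m P -> (forall u, u \in s -> P u) ->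
  P g \/ exists c, forall u, u \in s -> dot u c < dot g c.
Proof.
move=> cP sP.
pose lift (u : 'rV[R]_m) : 'rV[R]_(m + 1) := row_mx u 1.
pose C w := w = 0 \/ exists t u, [/\ 0 < t, P u & w = t *: lift u].
have C0 : C 0 by left.
have CD x y : C x -> C y -> C (x + y).
  case=> [->|[t [u [t0 Pu ->]]]]; first by rewrite add0r.
  case=> [->|[t' [u' [t'0 Pu' ->]]]].
    by rewrite addr0; right; exists t, u.
  right; exists (t + t'), ((t / (t + t')) *: u + (1 - t / (t + t')) *: u').
  have tt0 : 0 < t + t' by rewrite addr_gt0.
  split=> //.
    apply: convex_set_comb => //; first by rewrite divr_ge0 ?ltW.
    by rewrite ler_pdivrMr // mul1r lerDl ltW.
  rewrite !scale_row_mx add_row_mx -scalerDl scalerDr !scalerA mulrBr mulr1.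
  by rewrite mulrC divfK ?gt_eqF // addrAC subrr add0r.
have CZ t x : 0 <= t -> C x -> C (t *: x).
  rewrite le_eqVlt => /predU1P[<- _|t0]; first by rewrite scale0r.
  case=> [->|[t' [u [t'0 Pu ->]]]]; first by left; rewrite scaler0.
  by right; exists (t * t'), u; rewrite scalerA mulr_gt0.
have [a /mapP[u /sP Pu ->]||] :=
    @farkas _ _ C [seq lift u | u <- s] (lift g) C0 CD CZ.
- by right; exists 1, u; rewrite scale1r.
- case=> [/(congr1 rsubmx)|[t [u [t0 Pu]]]].
    by rewrite row_mxKr linear0 => /matrixP/(_ 0 0)/eqP; rewrite !mxE oner_eq0.
  rewrite scale_row_mx => /eq_row_mx[-> /matrixP/(_ 0 0)].
  by rewrite !mxE mulr1 => <-; rewrite scale1r; left.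
- case=> x sx gx; right; exists (lsubmx x) => u su.
  have := le_lt_trans (sx _ (map_f _ su)) gx.
  by rewrite -[x]hsubmxK !dot_row_mx ltrD2r row_mxKl.
Qed.

(** * Weighted degrees *)

Section Filtrations.

Variable R : realFieldType.

(** [F r x] is to be read as: the degree of [x] is at most [r].  The degree is
real-valued, since the separating weights are real, and [filtration] is what
makes determinants and polynomial coefficients easy to bound.  It is kept
abstract because the same theory serves for K, K[x] and K[x][X]. *)
Record filtration (S : comNzRingType) (F : R -> S -> Prop) : Prop := {
  filt0 : forall r, F r 0;
  filt1 : F 0 1;
  filtD : forall r x y, F r x -> F r y -> F r (x + y);
  filtN : forall r x, F r x -> F r (- x);
  filtM : forall r s x y, F r x -> F s y -> F (r + s) (x * y) }.

Section FiltrationTheory.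

Variables (S : comNzRingType) (F : R -> S -> Prop).
Hypothesis hF : filtration F.

Lemma filtB r x y : F r x -> F r y -> F r (x - y).
Proof. by move=> Fx Fy; apply: (filtD hF) => //; apply: (filtN hF). Qed.

Lemma filtMn r x k : F r x -> F r (x *+ k).
Proof.
move=> Fx; elim: k => [|k IHk]; first by rewrite mulr0n; apply: (filt0 hF).
by rewrite mulrSr; apply: (filtD hF).
Qed.

Lemma filt_sum I (s : seq I) (P : pred I) r (x : I -> S) :
  (forall i, P i -> F r (x i)) -> F r (\sum_(i <- s | P i) x i).
Proof.
move=> Fx; apply: (big_ind (F r)) => // [|a b]; first exact: (filt0 hF).
exact: (filtD hF).
Qed.

Lemma filtX r x k : F r x -> F (r *+ k) (x ^+ k).
Proof.
move=> Fx; elim: k => [|k IHk]; first exact: (filt1 hF).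
by rewrite exprS mulrS; apply: (filtM hF).
Qed.

Lemma filt_sign (b : bool) : F 0 ((-1) ^+ b).
Proof.
case: b; rewrite ?expr1 ?expr0; last exact: (filt1 hF).
exact/(filtN hF)/(filt1 hF).
Qed.

Lemma filt_prod k r (x : 'I_k -> S) :
  (forall i, F r (x i)) -> F (r *+ k) (\prod_i x i).
Proof.
elim: k x => [|k IHk] x Fx; first by rewrite big_ord0; apply: (filt1 hF).
by rewrite big_ord_recl mulrS; apply: (filtM hF) => //; apply: IHk.
Qed.

Lemma filt_det k r (A : 'M[S]_k) :
  (forall i j, F r (A i j)) -> F (r *+ k) (\det A).
Proof.
move=> FA; apply: filt_sum => s _; rewrite -[_ *+ k]add0r.
by apply: (filtM hF); [apply: filt_sign | apply: filt_prod].
Qed.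

End FiltrationTheory.

(** Nonzero constants have degree 0, and 0 has degree minus infinity. *)
Definition const_filt (K : nzRingType) (r : R) (a : K) : Prop :=
  a = 0 \/ 0 <= r.

Lemma const_filtP (K : comNzRingType) : filtration (@const_filt K).
Proof.
split=> [r||r x y|r x|r s x y]; first by left.
- by right.
- by case=> [->|]; [rewrite add0r | right].
- by case=> [->|]; [rewrite oppr0; left | right].
case=> [->|r0]; first by rewrite mul0r; left.
by case=> [->|s0]; [rewrite mulr0; left | right; rewrite addr_ge0].
Qed.

Section MpolyFiltration.

Variables (n : nat) (c : 'I_n -> R).

Definition weight (u : 'X_{1..n}) : R := \sum_k (u k)%:R * c k.

Lemma weight0 : weight 0%MM = 0.
Proof. by rewrite /weight big1 // => k _; rewrite mnm0E mul0r. Qed.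

Lemma weightD u v : weight (u + v)%MM = weight u + weight v.
Proof.
by rewrite -big_split; apply: eq_bigr => k _; rewrite mnmDE natrD mulrDl.
Qed.

Lemma weight1 i : weight U_(i)%MM = c i.
Proof.
rewrite /weight (bigD1 i) //= big1 ?addr0 => [|k ki].
  by rewrite mnm1E eqxx mul1r.
by rewrite mnm1E eq_sym (negPf ki) mul0r.
Qed.

(** Joint degree: the degree of a monomial is that of its coefficient plus its
weight. *)
Definition mpoly_filt (S : nzRingType) (F : R -> S -> Prop) (r : R)
  (p : {mpoly S[n]}) : Prop := forall u, F (r - weight u) p@_u.

Section MpolyFiltrationTheory.

Variables (S : comNzRingType) (F : R -> S -> Prop).
Hypothesis hF : filtration F.

Lemma mpoly_filtC r a : F r a -> mpoly_filt F r a%:MP.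
Proof.
move=> Fa u; rewrite mcoeffC; have [->|_] := eqVneq.
  by rewrite weight0 subr0 mulr1.
by rewrite mulr0; apply: (filt0 hF).
Qed.

Lemma mpoly_filtXU i : mpoly_filt F (c i) 'X_i.
Proof.
move=> u; rewrite mcoeffX; have [<-|_] := eqVneq.
  by rewrite weight1 subrr; apply: (filt1 hF).
exact: (filt0 hF).
Qed.

Lemma mpoly_filtP : filtration (mpoly_filt F).
Proof.
split=> [r u||r p q Fp Fq u|r p Fp u|r s p q Fp Fq u].
- by rewrite mcoeff0; apply: (filt0 hF).
- by rewrite -mpolyC1; apply: mpoly_filtC; apply: (filt1 hF).
- by rewrite mcoeffD; apply: (filtD hF).
- by rewrite mcoeffN; apply: (filtN hF).
rewrite mcoeffM; apply: (filt_sum hF) => k /eqP uE.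
have -> : weight u = weight k.1 + weight k.2 by rewrite -weightD -uE.
by rewrite opprD addrACA; apply: (filtM hF).
Qed.

Lemma mpoly_filt_deriv r p i :
  mpoly_filt F r p -> mpoly_filt F (r - c i) p^`M(i).
Proof.
move=> Fp u; rewrite mcoeff_deriv; apply: (filtMn hF).
by rewrite addrAC -addrA -opprD -weight1 -weightD.
Qed.

End MpolyFiltrationTheory.

(** When [r] is the weighted degree of [p], this is the leading form of [p];
leading forms multiply without cancellation in a domain, which is why degrees
add. *)
Definition top_part (S : nzRingType) r (p : {mpoly S[n]}) : {mpoly S[n]} :=
  \sum_(u <- msupp p | weight u == r) p@_u *: 'X_[u].

Lemma mcoeff_top_part (S : nzRingType) r (p : {mpoly S[n]}) u :
  (top_part r p)@_u = if weight u == r then p@_u else 0.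
Proof.
rewrite raddf_sum /= big_mkcond /=.
rewrite -[RHS](_ : (if weight u == r then p else 0)@_u = _); last first.
  by case: ifP => // _; rewrite mcoeff0.
rewrite {3}[p]mpolyE; case: ifP => ur; last rewrite mcoeff0.
  rewrite raddf_sum /=; apply: eq_bigr => v _; rewrite mcoeffZ mcoeffX.
  by have [->|_] := eqVneq v u; [rewrite ur | rewrite mulr0 if_same].
rewrite big1 // => v _; rewrite mcoeffZ mcoeffX.
by have [->|_] := eqVneq v u; [rewrite ur | rewrite mulr0 if_same].
Qed.

Variable K : idomainType.

Local Notation weight_le := (mpoly_filt (@const_filt K)).

Lemma weight_leP r (p : {mpoly K[n]}) :
  weight_le r p <-> forall u, u \in msupp p -> weight u <= r.
Proof.
split=> [pr u|pr u].
  by rewrite mcoeff_msupp; case: (pr u) => [->|]; rewrite ?eqxx ?subr_ge0.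
have [/pr ur|/memN_msupp_eq0 ->] := boolP (u \in msupp p); last by left.
by right; rewrite subr_ge0.
Qed.

Definition has_weight r (p : {mpoly K[n]}) : Prop :=
  weight_le r p /\ exists2 u, u \in msupp p & weight u = r.

Lemma has_weightM r s p q :
  has_weight r p -> has_weight s q -> has_weight (r + s) (p * q).
Proof.
move=> [pr [u up ur]] [qs [v vq vs]]; split.
  exact: (filtM (mpoly_filtP (const_filtP K))).
have tp0 : top_part r p != 0.
  apply: contraTneq up => /(congr1 (mcoeff u)).
  by rewrite mcoeff_top_part ur eqxx mcoeff0 => /eqP; rewrite mcoeff_eq0.
have tq0 : top_part s q != 0.
  apply: contraTneq vq => /(congr1 (mcoeff v)).
  by rewrite mcoeff_top_part vs eqxx mcoeff0 => /eqP; rewrite mcoeff_eq0.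
have := mlead_supp (mulf_neq0 tp0 tq0); set w := mlead _.
rewrite mcoeff_msupp => tw0.
have ww : weight w = r + s.
  apply: contraNeq tw0 => /eqP nw; rewrite mcoeffM big1 // => k /eqP wE.
  rewrite !mcoeff_top_part; case: eqP => [k1|]; last by rewrite mul0r.
  case: eqP => [k2|]; last by rewrite mulr0.
  by case: nw; rewrite -k1 -k2 -weightD -wE.
exists w => //; rewrite mcoeff_msupp; apply: contra_neq tw0 => <-.
rewrite !mcoeffM; apply: eq_bigr => k /eqP wE; rewrite !mcoeff_top_part.
have k12 : weight k.1 + weight k.2 = r + s by rewrite -weightD -wE.
have [k1|k1] := eqVneq (weight k.1) r.
  by rewrite ifT //; apply/eqP/(addrI r); rewrite -k12 k1.
rewrite mul0r; case: (pr k.1) => [->|]; first by rewrite mul0r.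
case: (qs k.2) => [->|]; first by rewrite mulr0.
rewrite !subr_ge0 => k2s k1r; suff: weight k.1 + weight k.2 < r + s.
  by rewrite k12 ltxx.
by apply: ltr_leD => //; rewrite lt_neqAle k1.
Qed.

Lemma has_weightX r p k : has_weight r p -> has_weight (r *+ k) (p ^+ k).
Proof.
move=> rp; elim: k => [|k IHk]; last by rewrite exprS mulrS; apply: has_weightM.
split; first exact: (filt1 (mpoly_filtP (const_filtP K))).
by exists 0%MM; rewrite ?weight0 // expr0 -mpolyC1 msuppC oner_eq0 inE.
Qed.

End MpolyFiltration.

End Filtrations.

(** * Determinants of tensor products and Cramer's rule *)

Section Determinants.

Variable S : comNzRingType.

Lemma det_mxsub_bij p q (f : 'I_p -> 'I_q) (A : 'M[S]_q) :
  bijective f -> \det (mxsub f f A) = \det A.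
Proof.
move=> bf; have pq : p = q.
  by rewrite -(card_ord p) -(card_ord q) (bij_eq_card bf).
case: q / pq in f A bf *.
pose s := perm (bij_inj bf).
have -> : mxsub f f A = row_perm s (col_perm s A).
  by apply/matrixP => i j; rewrite !mxE !permE.
rewrite row_permE col_permE !det_mulmx !det_perm mulrC -mulrA -signr_addb.
by rewrite odd_permV addbb mulr1.
Qed.

Lemma det_castmx p q (e e' : p = q) (A : 'M[S]_p) :
  \det (castmx (e, e') A) = \det A.
Proof.
by rewrite (eq_irrelevance e' e); case: q / e {e'}; rewrite castmx_id.
Qed.

Lemma det_tens1mx d k (A : 'M[S]_k) :
  \det ((1%:M : 'M_d) *t A) = \det A ^+ d.
Proof.
elim: d => [|d IHd]; first by rewrite det_mx00.
have -> : (1%:M : 'M[S]_(1 + d)) = block_mx 1%:M 0 0 1%:M.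
  by rewrite scalar_mx_block.
rewrite tens_block_mx !tens0mx det_castmx det_ublock IHd tens_scalar_mx.
by rewrite det_castmx scale1r exprS.
Qed.

(** Exchanging the two tensor factors is a simultaneous permutation of rows and
columns, which reduces this to the block diagonal case [det_tens1mx]. *)
Lemma det_tensmx1 d k (A : 'M[S]_k) :
  \det (A *t (1%:M : 'M_d)) = \det A ^+ d.
Proof.
rewrite -det_tens1mx.
pose f (x : 'I_(k * d)) : 'I_(d * k) :=
  mxtens_index ((mxtens_unindex x).2, (mxtens_unindex x).1).
pose g (x : 'I_(d * k)) : 'I_(k * d) :=
  mxtens_index ((mxtens_unindex x).2, (mxtens_unindex x).1).
rewrite -(@det_mxsub_bij _ _ f); last first.
  exists g => x; rewrite /f /g !mxtens_indexK -surjective_pairing;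
  exact: mxtens_unindexK.
congr (\det _); apply/matrixP => i j; rewrite !mxE /f !mxtens_indexK /=.
by rewrite mulrC.
Qed.

Lemma cramer_adj k p (H : 'M[S]_k) (Z : 'M[S]_(k, p)) i j :
  (\adj H *m Z) i j = \det (\matrix_(a, b) if b == i then Z a j else H a b).
Proof.
rewrite (expand_det_col _ i) mxE; apply: eq_bigr => a _.
rewrite [X in _ = X * _]mxE eqxx [\adj H i a]mxE mulrC.
congr (_ * (_ * \det _)).
apply/matrixP => x y; rewrite !mxE -if_neg.
by rewrite eq_sym neq_lift.
Qed.

End Determinants.

(** * Selecting columns of [1 M] and differentiating *)

Section SelectedColumns.

Variables (S : comNzRingType) (l : nat) (s : 'S_(l + l)).

(** A permutation [s] of the columns splits a matrix into the [l] chosen columns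
and the [l] remaining ones. *)
Definition left_sel (W : 'M[S]_(l, l + l)) := lsubmx (col_perm s W).
Definition right_sel (W : 'M[S]_(l, l + l)) := rsubmx (col_perm s W).

Lemma left_selM (D : 'M_l) W : left_sel (D *m W) = D *m left_sel W.
Proof. by rewrite /left_sel mulmx_lsub !col_permE mulmxA. Qed.

Lemma right_selM (D : 'M_l) W : right_sel (D *m W) = D *m right_sel W.
Proof. by rewrite /right_sel mulmx_rsub !col_permE mulmxA. Qed.

(** With [U = beta N] this is det H * det (beta Q) = +- beta^l, the Schur
complement formula for the column permutation [H Z; X Y] of the matrix
[1 M; 0 1]. *)
Lemma det_pivot (M U : 'M[S]_l) beta :
  left_sel (row_mx 1%:M M) *m U = beta *: right_sel (row_mx 1%:M M) ->
  \det (left_sel (row_mx 1%:M M)) *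
    \det (beta *: right_sel (row_mx 0 1%:M) - left_sel (row_mx 0 1%:M) *m U)
  = (-1) ^+ s * beta ^+ l.
Proof.
set H := left_sel _; set Z := right_sel _.
set X := left_sel _; set Y := right_sel _.
move=> HU.
have : block_mx H Z X Y *m block_mx 1%:M (- U) 0 beta%:M =
       block_mx H 0 X (beta *: Y - X *m U).
  rewrite mulmx_block !mulmx1 !mulmx0 !addr0 !mulmxN !mul_mx_scalar HU addNr.
  by rewrite [- _ + _]addrC.
move/(congr1 determinant).
rewrite det_mulmx det_ublock det_lblock det1 mul1r det_scalar => <-.
congr (_ * _).
have -> : block_mx H Z X Y = col_perm s (block_mx 1%:M M 0 1%:M).
  rewrite block_mxEv /H /Z /X /Y /left_sel /right_sel !hsubmxK.
  rewrite [block_mx 1%:M _ _ _]block_mxEv.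
  by apply/matrixP => a b; rewrite !mxE; case: splitP => c _; rewrite !mxE.
by rewrite col_permE det_mulmx det_ublock !det1 !mul1r det_perm odd_permV.
Qed.

End SelectedColumns.

Lemma exchange_left_sel (S : comNzRingType) l (s : 'S_(l + l))
    (W : 'M[S]_(l, l + l)) (i j : 'I_l) :
  \matrix_(a, b) (if b == i then right_sel s W a j else left_sel s W a b) =
    left_sel (tperm (lshift l i) (rshift l j) * s) W.
Proof.
apply/matrixP => a b; rewrite !mxE permM.
case: eqVneq => [->|bi]; first by rewrite tpermL.
by rewrite tpermD ?eq_rlshift ?(inj_eq (@lshift_inj _ _)) // eq_sym.
Qed.

Section Derivative.

Variables (K : fieldType) (m l : nat) (A : 'I_m -> 'M[K]_l) (s : 'S_(l + l)).

Local Notation M := (symbolic_mx A).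
Local Notation Dk k := (map_mx (@mpolyC m K) (A k)).

Local Notation dmx k := (map_mx (mderiv k)).

Lemma deriv_symbolic_mx k : dmx k M = Dk k.
Proof.
apply/matrixP => i j; rewrite !mxE summxE linear_sum (bigD1 k) //=.
rewrite big1 => [|a ak].
  rewrite addr0 !mxE mderivM mderivC mulr0 addr0 mderivX mnm1E eqxx scale1r.
  have -> : (U_(k) - U_(k) = 0 :> 'X_{1.. m})%MM.
    by apply/mnmP => a; rewrite mnmBE subnn mnm0E.
  by rewrite mpolyX0 mul1r.
rewrite !mxE mderivM mderivC mulr0 addr0 mderivX mnm1E (negPf ak).
by rewrite scale0r mul0r.
Qed.

Lemma deriv_mulmx k p q r (B : 'M[{mpoly K[m]}]_(p, q)) (C : 'M_(q, r)) :
  dmx k (B *m C) = dmx k B *m C + B *m dmx k C.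
Proof.
apply/matrixP => i j; rewrite !mxE linear_sum -big_split; apply: eq_bigr => a _.
by rewrite /= mderivM !mxE.
Qed.

Lemma deriv_scalemx k p q b (B : 'M[{mpoly K[m]}]_(p, q)) :
  dmx k (b *: B) = b^`M(k) *: B + b *: dmx k B.
Proof. by apply/matrixP => i j; rewrite !mxE mderivM. Qed.

Lemma deriv_row_mx k : dmx k (row_mx 1%:M M) = Dk k *m row_mx 0 1%:M.
Proof.
rewrite map_row_mx deriv_symbolic_mx mul_mx_row mulmx0 mulmx1; congr row_mx.
by apply/matrixP => i j; rewrite !mxE -mpolyC_nat mderivC.
Qed.

(** The derivative of H N = Z, multiplied by beta^2, for [U = beta N]. *)
Lemma pivot_deriv k (U : 'M_l) beta :
    left_sel s (row_mx 1%:M M) *m U = beta *: right_sel s (row_mx 1%:M M) ->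
  left_sel s (row_mx 1%:M M) *m (beta *: dmx k U - beta^`M(k) *: U) =
  beta *: (Dk k *m (beta *: right_sel s (row_mx 0 1%:M)
                      - left_sel s (row_mx 0 1%:M) *m U)).
Proof.
move=> HU; have := congr1 (map_mx (mderiv k)) HU.
rewrite deriv_mulmx deriv_scalemx.
rewrite /left_sel /right_sel map_lsubmx map_rsubmx !map_col_perm deriv_row_mx.
rewrite -!/(left_sel _ _) -!/(right_sel _ _) left_selM right_selM.
move/(canRL (addKr _)) => HdU.
rewrite mulmxBr -!scalemxAr HdU HU mulmxBr mulmxA -scalemxAr.
rewrite scalerA [beta^`M(k) * _]mulrC -scalerA -scalerBr.
congr (_ *: _).
by rewrite -addrA [X in _ + (X - _)]addrC addrK addrC.
Qed.

End Derivative.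

(** * The degree of the determinant of a blow-up *)

Section BlowupBound.

Definition generic_mx (S : nzRingType) (m d : nat) (k : 'I_m) :
    'M[{mpoly S[#|bvars m d|]}]_d := \matrix_(i, j) 'X_(bvar k i j).

(** The blow-up of a matrix pencil over any coefficient ring; over the field K
and for the submatrices A_k[I,J] it is [blowup] by conversion. *)
Definition pencil (S : nzRingType) (m l d : nat) (B : 'I_m -> 'M[S]_l) :
    'M[{mpoly S[#|bvars m d|]}]_(l * d) :=
  \sum_(k < m) (map_mx (@mpolyC #|bvars m d| S) (B k) *t generic_mx S d k).

Lemma map_pencil (S T : nzRingType) (f : {rmorphism S -> T}) m l d
    (B : 'I_m -> 'M[S]_l) :
  map_mx (map_mpoly f) (pencil d B) = pencil d (fun k => map_mx f (B k)).
Proof.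
rewrite /pencil raddf_sum; apply: eq_bigr => k _ /=.
apply/matrixP => i j; rewrite !mxE rmorphM /= map_mpolyC.
by rewrite map_mpolyX.
Qed.

(** A change of basis by [P] and [Q] common to all members of the pencil passes
to the blow-up as [P (x) 1] and [Q (x) 1]. *)
Lemma det_pencil (S : comNzRingType) m l d (b : S) (P Q : 'M[S]_l)
    (B C : 'I_m -> 'M[S]_l) :
    (forall k, P *m C k = b *: (B k *m Q)) ->
  (\det P ^+ d)%:MP * \det (pencil d C) =
  (b ^+ (l * d) * \det Q ^+ d)%:MP * \det (pencil d B).
Proof.
move=> PC; pose f := @mpolyC #|bvars m d| S.
have E : (map_mx f P *t 1%:M) *m pencil d C =
         b%:MP *: (pencil d B *m (map_mx f Q *t 1%:M)).
  rewrite mulmx_sumr mulmx_suml scaler_sumr; apply: eq_bigr => k _.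
  rewrite !tensmx_mul mul1mx mulmx1 -!map_mxM PC.
  by apply/matrixP => i j; rewrite !mxE rmorphM mulrA.
have := congr1 determinant E.
rewrite detZ !det_mulmx !det_tensmx1 !det_map_mx => {}E.
by rewrite rmorphM !rmorphXn /= E [X in _ * X = _]mulrC mulrA.
Qed.

Variables (R : realFieldType) (m : nat) (c : 'I_m -> R).

Definition blowup_weight d (v : 'I_#|bvars m d|) : R := c (enum_val v).1.1.

Lemma pencil_filt (S : comNzRingType) (F : R -> S -> Prop) l d r
    (B : 'I_m -> 'M[S]_l) : filtration F ->
    (forall k i j, F (r - c k) (B k i j)) ->
  mpoly_filt (@blowup_weight d) F (r *+ (l * d)) (\det (pencil d B)).
Proof.
move=> hF FB; apply: (filt_det (mpoly_filtP _ hF)) => i j.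
rewrite /pencil summxE; apply: (filt_sum (mpoly_filtP _ hF)) => k _.
rewrite !mxE -[r](subrK (c k)); apply: (filtM (mpoly_filtP _ hF)).
  exact: (mpoly_filtC _ hF).
have := mpoly_filtXU (@blowup_weight d) hF
  (bvar k (mxtens_unindex i).2 (mxtens_unindex j).2).
by rewrite /blowup_weight enum_rankK.
Qed.

Variables (K : fieldType) (l : nat) (A : 'I_m -> 'M[K]_l).

Local Notation weight_le := (mpoly_filt c (@const_filt R K)).

Definition basis_det (s : 'S_(l + l)) : {mpoly K[m]} :=
  \det (left_sel s (row_mx 1%:M (symbolic_mx A))).

(** If [s0] selects a maximal minor of [1 M] of largest degree [mu], the
blow-up has degree at most [2 d mu]; see the introduction for the argument. *)
Lemma blowup_bound d mu s0 z :
    (forall s, weight_le mu (basis_det s)) -> has_weight c mu (basis_det s0) ->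
    z \in msupp (\det (pencil d A)) ->
  weight (@blowup_weight d) z <= mu *+ (2 * d).
Proof.
move=> les max0 zA.
set beta := basis_det s0 in max0; have leb := max0.1.
set H := left_sel s0 (row_mx 1%:M (symbolic_mx A)).
set Z := right_sel s0 (row_mx 1%:M (symbolic_mx A)).
pose U := \adj H *m Z.
have HU : H *m U = beta *: Z by rewrite mulmxA mul_mx_adj mul_scalar_mx.
have leU i j : weight_le mu (U i j).
  by rewrite cramer_adj exchange_left_sel; apply: les.
move: U HU leU => U HU leU.
set bQ := beta *: right_sel s0 (row_mx 0 1%:M)
            - left_sel s0 (row_mx 0 1%:M) *m U.
have detQ : beta * \det bQ = (-1) ^+ s0 * beta ^+ l by apply: det_pivot.
pose G k := beta *: map_mx (mderiv k) U - beta^`M(k) *: U.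
have GE k : H *m G k = beta *: (map_mx (@mpolyC m K) (A k) *m bQ).
  exact: pivot_deriv.
have fK := const_filtP R K; have fKx := mpoly_filtP c fK.
have leG k i j : weight_le (mu *+ 2 - c k) (G k i j).
  rewrite !mxE mulr2n; apply: (filtB fKx); last first.
    rewrite addrAC; apply: (filtM fKx) => //.
    exact: (mpoly_filt_deriv fK).
  by rewrite -addrA; apply: (filtM fKx); [|apply: (mpoly_filt_deriv fK)].
have detG := pencil_filt (d := d) fKx leG.
have E : beta ^+ d * (\det (pencil d G))@_z =
    beta ^+ (l * d) * \det bQ ^+ d * ((\det (pencil d A))@_z)%:MP.
  have /(congr1 (mcoeff z)) := det_pencil d GE.
  by rewrite -(map_pencil (@mpolyC m K)) det_map_mx !mcoeffCM mcoeff_map_mpoly.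
set a := (\det (pencil d A))@_z in E.
have a0 : a != 0 by rewrite -mcoeff_msupp.
(* The factor beta^d replaces (det bQ)^d, which is +- beta^((l - 1) d), by
   +- beta^(l d); the exponent l - 1 would be truncated when l = 0. *)
have {}E : beta ^+ d * (beta ^+ d * (\det (pencil d G))@_z) =
    (-1) ^+ (s0 * d) * (beta ^+ (l * d) * beta ^+ (l * d)) * a%:MP.
  rewrite E mulrA; congr (_ * _).
  by rewrite mulrCA -exprMn detQ exprMn -!exprM mulrCA.
have wa : has_weight c 0 (a%:MP : {mpoly K[m]}).
  split; first by apply: (mpoly_filtC _ fK); right.
  by exists 0%MM; rewrite ?weight0 // msuppC (negPf a0) inE.
have [_ [u uE wu]] := has_weightM (has_weightX (l * d + l * d) max0) wa.
(* By E this polynomial is, up to sign, a coefficient of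
   beta^(2d) det (pencil d G), whereas its degree is exactly 2 l d mu. *)
have le_wa : weight_le
    (mu *+ d + mu *+ d + (mu *+ 2 *+ (l * d) - weight (@blowup_weight d) z))
    (beta ^+ (l * d + l * d) * a%:MP).
  have -> : beta ^+ (l * d + l * d) * a%:MP =
      (-1) ^+ odd (s0 * d) * (beta ^+ d * beta ^+ d * (\det (pencil d G))@_z).
    rewrite -[beta ^+ d * _ * _]mulrA E signr_odd exprD !mulrA.
    by rewrite -[(-1) ^+ _ * _]expr2 sqrr_sign mul1r.
  rewrite -[X in weight_le X]add0r.
  apply: (filtM fKx); first exact: (filt_sign fKx).
  by apply: (filtM fKx) => //; apply: (filtM fKx); apply: (filtX fKx).
have := (weight_leP _ _ _).1 le_wa u uE.
rewrite wu addr0 addrA lerBrDr.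
have -> : mu *+ d + mu *+ d + mu *+ 2 *+ (l * d) =
          mu *+ (l * d + l * d) + mu *+ (2 * d).
  by rewrite -mulrnA -!mulrnDr !mul2n !addnn addnC.
by rewrite lerD2l.
Qed.

End BlowupBound.

(** * Maximal minors of [1 M] are minors of A *)

Section Minors.

Variables (K : fieldType) (m n : nat) (A : 'I_m -> 'M[K]_n).

Definition minor_exponent (u : 'X_{1..m}) : Prop :=
  exists l (I J : {set 'I_n}) (hI : #|I| = l) (hJ : #|J| = l),
    u \in msupp (\det (square_submx hI hJ (symbolic_mx A))).

(** Being a signed minor of A or 0 is replaced by this property of the support,
which is also stable under sums: Laplace expansions then need no discussion of
which terms vanish. *)
Definition minor_supported (p : {mpoly K[m]}) : Prop :=
  forall u, u \in msupp p -> minor_exponent u.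

Lemma minor_supported0 : minor_supported 0.
Proof. by move=> u; rewrite msupp0. Qed.

Lemma minor_supportedN p : minor_supported p -> minor_supported (- p).
Proof. by move=> hp u; rewrite (perm_mem (msuppN p)); apply: hp. Qed.

Lemma minor_supportedD p q :
  minor_supported p -> minor_supported q -> minor_supported (p + q).
Proof. by move=> hp hq u /msuppD_le; rewrite mem_cat => /orP[/hp|/hq]. Qed.

Lemma minor_supported_sign (b : nat) p :
  minor_supported p -> minor_supported ((-1) ^+ b * p).
Proof.
move=> hp; rewrite -signr_odd mulr_sign; case: ifP => // _.
exact: minor_supportedN.
Qed.

Lemma injective_enum_val l (f : 'I_l -> 'I_n) : injective f ->
  exists (I : {set 'I_n}) (hI : #|I| = l) (s : 'S_l),
    forall i, f i = enum_val (cast_ord (esym hI) (s i)).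
Proof.
move=> injf; pose I := [set f i | i : 'I_l].
have hI : #|I| = l by rewrite card_imset ?card_ord.
have [i|s fs] := @fin_all_exists _ _
  (fun i j => f i = enum_val (cast_ord (esym hI) j)).
  have fI : f i \in I by apply: imset_f.
  exists (cast_ord hI (enum_rank_in fI (f i))).
  by rewrite cast_ordK enum_rankK_in.
have injs : injective s by move=> i j ij; apply: injf; rewrite !fs ij.
by exists I, hI, (perm injs) => i; rewrite permE.
Qed.

Lemma minor_supported_mxsub l (f g : 'I_l -> 'I_n) :
  minor_supported (\det (mxsub f g (symbolic_mx A))).
Proof.
have [injf|] := altP (injectiveP f); last first.
  case/injectivePn => i [j ij fij]; rewrite (determinant_alternate ij).
    exact: minor_supported0.
  by move=> k; rewrite !mxE fij.
have [injg|] := altP (injectiveP g); last first.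
  case/injectivePn => i [j ij gij]; rewrite -det_tr (determinant_alternate ij).
    exact: minor_supported0.
  by move=> k; rewrite !mxE gij.
have [I [hI [s fs]]] := injective_enum_val injf.
have [J [hJ [t gt]]] := injective_enum_val injg.
have -> : mxsub f g (symbolic_mx A) =
    row_perm s (col_perm t (square_submx hI hJ (symbolic_mx A))).
  by apply/matrixP => i j; rewrite !mxE fs gt.
rewrite row_permE col_permE !det_mulmx !det_perm [X in _ * X]mulrC.
do 2!apply: minor_supported_sign.
by move=> u uI; exists l, I, J, hI, hJ.
Qed.

Lemma mxsub_row_mx1_right l p q (N : 'M[{mpoly K[m]}]_(p, q))
    (f : 'I_l -> 'I_p) (g : 'I_l -> 'I_(p + q)) :
    (forall j, ~~ (g j < p)%N) ->
  exists h : 'I_l -> 'I_q, mxsub f g (row_mx 1%:M N) = mxsub f h N.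
Proof.
move=> gN; have [j|h gh] := @fin_all_exists _ _ (fun j x => g j = rshift p x).
  by case: (split_ordP (g j)) (gN j) => x ->; rewrite ?ltn_ord //; exists x.
by exists h; apply/matrixP => i j; rewrite [LHS]mxE gh row_mxEr [RHS]mxE.
Qed.

(** Columns taken from the identity block are removed one at a time by Laplace
expansion. *)
Lemma minor_supported_row_mx1 p q (N : 'M[{mpoly K[m]}]_(p, q)) :
    (forall l (f : 'I_l -> 'I_p) (g : 'I_l -> 'I_q),
       minor_supported (\det (mxsub f g N))) ->
  forall l (f : 'I_l -> 'I_p) (g : 'I_l -> 'I_(p + q)),
    minor_supported (\det (mxsub f g (row_mx 1%:M N))).
Proof.
move=> hN; elim=> [|l IHl] f g;
    have [/existsP[j gj]|/existsPn gN] := boolP [exists j, (g j < p)%N].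
- by case: j {gj}.
- by have [h ->] := mxsub_row_mx1_right N f gN.
- rewrite (expand_det_col _ j).
  apply: big_ind => [||i _].
  - exact: minor_supported0.
  - exact: minor_supportedD.
  rewrite [mxsub _ _ _ i j]mxE.
  have -> : g j = lshift q (Ordinal gj) by apply: val_inj.
  rewrite row_mxEl mxE; case: eqP => _; last first.
    by rewrite mul0r; apply: minor_supported0.
  rewrite mul1r; apply: minor_supported_sign.
  have -> : row' i (col' j (mxsub f g (row_mx 1%:M N))) =
      mxsub (fun a => f (lift i a)) (fun b => g (lift j b)) (row_mx 1%:M N).
    by apply/matrixP => a b; rewrite !mxE.
  exact: IHl.
by have [h ->] := mxsub_row_mx1_right N f gN.
Qed.

(** The finite list of generators to which [convex_separation] is applied. *)
Definition minor_exponents : seq 'X_{1..m} :=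
  flatten [seq
    if #|IJ.2| =P #|IJ.1| is ReflectT e
    then msupp (\det (square_submx (erefl #|IJ.1|) e (symbolic_mx A))) else [::]
    | IJ : {set 'I_n} * {set 'I_n}].

Lemma minor_exponentP u : (u \in minor_exponents) <-> minor_exponent u.
Proof.
split=> [/flatten_mapP[[I J] _]|[l [I [J [hI [hJ]]]]]] /=.
  by case: eqP => // e uI; exists #|I|, I, J, erefl, e.
case: l / hI hJ => hJ uI; apply/flatten_mapP; exists (I, J) => /=.
  by rewrite mem_enum.
case: eqP => [e|]; last by case/(_ hJ).
by rewrite (eq_irrelevance e hJ); exact: uI.
Qed.

End Minors.

Lemma symbolic_mx_square_submx (K : fieldType) m n l (A : 'I_m -> 'M[K]_n)
    (I J : {set 'I_n}) (hI : #|I| = l) (hJ : #|J| = l) :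
  symbolic_mx (fun k => square_submx hI hJ (A k)) =
  square_submx hI hJ (symbolic_mx A).
Proof.
apply/matrixP => i j; rewrite [RHS]mxE !summxE; apply: eq_bigr => k _.
by rewrite !mxE.
Qed.

(** * Comparison of the two polytopes *)

Lemma seq_has_max (R : realFieldType) (T : eqType) (w : T -> R) (s : seq T) x :
  x \in s -> exists2 y, y \in s & forall z, z \in s -> w z <= w y.
Proof.
elim: s x => // a s IHs x _.
case: s IHs => [|b s] IHs.
  by exists a; rewrite ?mem_head // => z; rewrite inE => /eqP ->.
have [y ys maxy] := IHs b (mem_head _ _).
have [le_ya|/ltW le_ay] := lerP (w y) (w a); [exists a | exists y].
- exact: mem_head.
- move=> z; rewrite inE => /predU1P[-> //|/maxy le_zy].
  exact: le_trans le_ya.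
- by rewrite inE ys orbT.
- by move=> z; rewrite inE => /predU1P[-> //|/maxy].
Qed.

(** The maximum exists because the identity permutation selects the block 1, so
that not all of these determinants vanish. *)
Lemma exists_max_basis (R : realFieldType) (K : fieldType) m l (c : 'I_m -> R)
    (A : 'I_m -> 'M[K]_l) :
  exists mu (s0 : 'S_(l + l)),
    (forall s, mpoly_filt c (@const_filt R K) mu (basis_det A s)) /\
    has_weight c mu (basis_det A s0).
Proof.
pose E := flatten [seq msupp (basis_det A s) | s : 'S_(l + l)].
have E0 : 0%MM \in E.
  apply/flatten_mapP; exists 1%g; first by rewrite mem_enum.
  rewrite /basis_det /left_sel col_perm1 row_mxKl det1 -mpolyC1 msuppC.
  by rewrite oner_eq0 mem_head.
have [u /flatten_mapP[s0 _ us0] maxu] := seq_has_max (weight c) E0.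
have le s : mpoly_filt c (@const_filt R K) (weight c u) (basis_det A s).
  apply/weight_leP => v vs; apply: maxu; apply/flatten_mapP; exists s => //.
  by rewrite mem_enum.
by exists (weight c u), s0; split=> //; split=> //; exists u.
Qed.

Lemma basis_det_minor_supported (K : fieldType) m n l (A : 'I_m -> 'M[K]_n)
    (I J : {set 'I_n}) (hI : #|I| = l) (hJ : #|J| = l) (s : 'S_(l + l)) :
  minor_supported A (basis_det (fun k => square_submx hI hJ (A k)) s).
Proof.
rewrite /basis_det symbolic_mx_square_submx.
set N := square_submx _ _ _.
have -> : left_sel s (row_mx 1%:M N) =
    mxsub (fun i => i) (fun j => s (lshift l j)) (row_mx 1%:M N).
  by apply/matrixP => i j; rewrite !mxE.
apply: minor_supported_row_mx1 => k f g.
have -> : mxsub f g N = mxsub (fun i => enum_val (cast_ord (esym hI) (f i)))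
    (fun j => enum_val (cast_ord (esym hJ) (g j))) (symbolic_mx A).
  by apply/matrixP => i j; rewrite !mxE.
exact: minor_supported_mxsub.
Qed.

Lemma weight_blowup (R : realType) m d (c : 'I_m -> R)
    (z : 'X_{1..#|bvars m d|}) :
  weight (blowup_weight c (d := d)) z =
  \sum_k (\sum_i \sum_j (z (bvar k i j))%:R) * c k.
Proof.
rewrite /weight (reindex (@enum_rank (bvars m d))) /=; last first.
  exact: onW_bij (enum_rank_bij _).
under [RHS]eq_bigr => k _ do rewrite mulr_suml.
rewrite pair_bigA; under [RHS]eq_bigr => ki _ do rewrite mulr_suml.
rewrite pair_bigA; apply: eq_bigr => -[[k i] j] _ /=.
by rewrite /blowup_weight enum_rankK.
Qed.

Lemma convex_polytopeP (R : realType) (K : fieldType) m n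
    (A : 'I_m -> 'M[K]_n) :
  @convex_set R 'rV[R]_m (polytopeP R A).
Proof.
move=> x y t; rewrite !inE => Px Py B [cB AB].
by have := cB x y t; rewrite !inE; apply; [apply: Px | apply: Py].
Qed.

Lemma dot_expvec (R : realType) m (u : 'X_{1..m}) (c : 'rV[R]_m) :
  dot (expvec R u) c = weight (c 0) u.
Proof. by apply: eq_bigr => k _; rewrite mxE. Qed.

Lemma dot_projd (R : realType) m d (z : 'X_{1..#|bvars m d|}) (c : 'rV[R]_m) :
  (0 < d)%N ->
  weight (blowup_weight (c 0) (d := d)) z =
  dot (2%:R^-1 *: projd R z) c *+ (2 * d).
Proof.
move=> d0; rewrite weight_blowup -[RHS]mulr_natl natrM mulr_sumr.
apply: eq_bigr => k _.
rewrite !mxE [2%:R^-1 * _]mulrA -invfM !mulrA mulfV ?mul1r //.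
by rewrite mulf_neq0 // pnatr_eq0 -lt0n.
Qed.

(** A separating weight [c] would make the weight of the point larger than [mu],
the weight of a generator of the polytope; multiplied by 2 d this contradicts
[blowup_bound]. *)
Lemma half_projd_in_polytopeP (R : realType) (K : fieldType) m n d l
    (A : 'I_m -> 'M[K]_n) (I J : {set 'I_n}) (hI : #|I| = l) (hJ : #|J| = l)
    (z : 'X_{1..#|bvars m d|}) :
  (0 < d)%N -> z \in msupp (\det (blowup A d hI hJ)) ->
  polytopeP R A (2%:R^-1 *: projd R z).
Proof.
move=> d0 zA.
have [u /mapP[v /minor_exponentP vA ->]|//|[c cP]] :=
  @convex_separation _ _ _ [seq expvec R u | u <- minor_exponents A]
    (2%:R^-1 *: projd R z) (@convex_polytopeP R K m n A).
  apply: sub_gen_smallest; case: vA => k [I' [J' [hI' [hJ' vA]]]].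
  by exists k, I', J', hI', hJ', v.
have [mu [s0 [le_mu max_mu]]] :=
  exists_max_basis (c 0) (fun k => square_submx hI hJ (A k)).
have := blowup_bound le_mu max_mu zA.
rewrite dot_projd // lerMn2r muln_eq0 /= -leqn0 leqNgt d0 /=.
case: max_mu => _ [u /basis_det_minor_supported /minor_exponentP uA <-].
by rewrite leNgt -dot_expvec cP // map_f.
Qed.

Theorem theorem3p5 (K : fieldType) (R : realType) (m n : nat)
    (A : 'I_m -> 'M[K]_n) :
  [set (2%:R^-1 : R) *: u | u in polytopeQ R A] `<=` polytopeP R A.
Proof.
move=> _ [u Qu <-].
apply: (Qu [set v | polytopeP R A (2%:R^-1 *: v)]); split=> [x y t|].
  rewrite !inE /= => Px Py.
  have := @convex_polytopeP R K m n A (2%:R^-1 *: x) (2%:R^-1 *: y) t.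
  rewrite !inE => /(_ Px Py); rewrite /conv /=.
  by rewrite [2%:R^-1 *: (_ + _)]scalerDr !scalerA ![2%:R^-1 * _]mulrC.
move=> _ [d d0] [l _] [I [J [hI [hJ [z [zA ->]]]]]].
exact: half_projd_in_polytopeP zA.
Qed.
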